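(* Let $\mathbb{K}$ be a field with $\operatorname{char}(\mathbb{K}) \neq 2$, let $V$ be a $\mathbb{K}$-vector space of dimension $4$, and let $\{e_1^*, e_2^*, e_3^*, e_4^*\}$ be a basis of the dual space $V^*$. Let ${\det}_4 = \sum_{\sigma \in S_4} \operatorname{sgn}(\sigma)\, e_{\sigma(1)}^* \otimes e_{\sigma(2)}^* \otimes e_{\sigma(3)}^* \otimes e_{\sigma(4)}^* \in (V^* )^{\otimes 4}$ be the $4\times 4$ determinant tensor. Then the following identity holds in $(V^* )^{\otimes 4}$: \begin{equation*} \begin{aligned} {\det}_4=\frac{1}{2}\big( &(e^{*}_1-e^{*}_2)\otimes (e^{*}_3-e^{*}_4)\otimes (e^{*}_3+e^{*}_4)\otimes (e^{*}_1+e^{*}_2)\\ &-(e^{*}_1-e^{*}_3)\otimes (e^{*}_2-e^{*}_4)\otimes (e^{*}_2+e^{*}_4)\otimes (e^{*}_1+e^{*}_3)\\ &+(e^{*}_1-e^{*}_4)\otimes (e^{*}_2-e^{*}_3)\otimes (e^{*}_2+e^{*}_3)\otimes (e^{*}_1+e^{*}_4)\\ &+(e^{*}_2-e^{*}_3)\otimes (e^{*}_1-e^{*}_4)\otimes (e^{*}_1+e^{*}_4)\otimes (e^{*}_2+e^{*}_3)\\ &-(e^{*}_2-e^{*}_4)\otimes (e^{*}_1-e^{*}_3)\otimes (e^{*}_1+e^{*}_3)\otimes (e^{*}_2+e^{*}_4)\\ &+(e^{*}_3-e^{*}_4)\otimes (e^{*}_1-e^{*}_2)\otimes (e^{*}_1+e^{*}_2)\otimes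 (e^{*}_3+e^{*}_4)\\ &+(e^{*}_1+e^{*}_2)\otimes (e^{*}_3+e^{*}_4)\otimes (e^{*}_3-e^{*}_4)\otimes (e^{*}_1-e^{*}_2)\\ &-(e^{*}_1+e^{*}_3)\otimes (e^{*}_2+e^{*}_4)\otimes (e^{*}_2-e^{*}_4)\otimes (e^{*}_1-e^{*}_3)\\ &+(e^{*}_1+e^{*}_4)\otimes (e^{*}_2+e^{*}_3)\otimes (e^{*}_2-e^{*}_3)\otimes (e^{*}_1-e^{*}_4)\\ &+(e^{*}_2+e^{*}_3)\otimes (e^{*}_1+e^{*}_4)\otimes (e^{*}_1-e^{*}_4)\otimes (e^{*}_2-e^{*}_3)\\ &-(e^{*}_2+e^{*}_4)\otimes (e^{*}_1+e^{*}_3)\otimes (e^{*}_1-e^{*}_3)\otimes (e^{*}_2-e^{*}_4)\\ &+(e^{*}_3+e^{*}_4)\otimes (e^{*}_1+e^{*}_2)\otimes (e^{*}_1-e^{*}_2)\otimes (e^{*}_3-e^{*}_4)\big). \end{aligned} \end{equation*}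
   Context: For a $\mathbb{K}$-vector space $V$ of dimension $n$, with $\{e_1^*,\dots,e_n^*\}$ a basis of the dual space $V^*$, the $n\times n$ determinant tensor is ${\det}_n = \sum_{\sigma\in S_n} \operatorname{sgn}(\sigma)\, e_{\sigma(1)}^*\otimes\cdots\otimes e_{\sigma(n)}^* \in (V^* )^{\otimes n}$, where $\operatorname{sgn}(\sigma)$ is the sign of the permutation $\sigma$. It is identified with an $n$-linear map $V\times\cdots\times V\to\mathbb{K}$ ($n$ copies of $V$), where $V \times \cdots \times V$ is regarded as the space of $n\times n$ matrices over $\mathbb{K}$. *)

(* Defs.v *)
From HB Require Import structures.
From mathcomp Require Import all_boot all_order all_algebra all_fingroup.

Set Implicit Arguments.
Unset Strict Implicit.
Unset Printing Implicit Defensive.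

Import GRing.Theory.
Local Open Scope ring_scope.

Definition dual (K : fieldType) (V : vectType K) : vectType K := 'Hom(V, K^o).

Definition set_tnth (A : Type) (n : nat) (w : n.-tuple A) (i : 'I_n) (x : A) :
    n.-tuple A :=
  [tuple if j == i then x else tnth w j | j < n].

Definition multilinear (K : fieldType) (W U : lmodType K) (n : nat)
    (f : n.-tuple W -> U) : Prop :=
  forall (w : n.-tuple W) (i : 'I_n) (a : K) (x y : W),
    f (set_tnth w i (a *: x + y)) =
    a *: f (set_tnth w i x) + f (set_tnth w i y).

(* The n-th tensor power of W is specified by its universal property:         *)
(* T is a model of it, and t [tuple w_1; ...; w_n] is w_1 (x) ... (x) w_n.    *)
(* Lemma tensor_power_exists shows that finite-dimensional W have a model.    *)
Definition is_tensor_power (K : fieldType) (W T : lmodType K) (n : nat)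
    (t : n.-tuple W -> T) : Prop :=
  multilinear t /\
  forall (U : lmodType K) (f : n.-tuple W -> U), multilinear f ->
    (exists g : {linear T -> U}, forall w, g (t w) = f w) /\
    (forall g h : {linear T -> U},
       (forall w, g (t w) = f w) -> (forall w, h (t w) = f w) -> g =1 h).

Definition det_tensor (K : fieldType) (W T : lmodType K) (n : nat)
    (t : n.-tuple W -> T) (e : n.-tuple W) : T :=
  \sum_(s : 'S_n) (-1) ^+ s *: t [tuple tnth e (s i) | i < n].

Section Existence.

Variables (K : fieldType) (W : vectType K) (n : nat).

Let d := \dim {:W}.
Let b : d.-tuple W := vbasis {:W}.

Let tens (w : n.-tuple W) : {ffun {ffun 'I_n -> 'I_d} -> K^o} :=
  [ffun k : {ffun 'I_n -> 'I_d} => \prod_i coord b (k i) (tnth w i)].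

Let tnth_set (A : Type) (w : n.-tuple A) i x j :
  tnth (set_tnth w i x) j = if j == i then x else tnth w j.
Proof. by rewrite tnth_mktuple. Qed.

Let tens_lin : multilinear tens.
Proof.
move=> w i a x y; apply/ffunP => k; rewrite !ffunE.
rewrite !(bigD1 (P := predT) i) //= !tnth_set eqxx linearP /= mulrDl.
set A := \prod_(_ < n | _) _; set B := \prod_(_ < n | _) _.
set C := \prod_(_ < n | _) _.
have eB : A = B by apply: eq_bigr => j /negPf ji; rewrite !tnth_set ji.
have eC : A = C by apply: eq_bigr => j /negPf ji; rewrite !tnth_set ji.
by rewrite -eB -eC /GRing.scale /= mulrA.
Qed.

Let bvec (k : {ffun 'I_n -> 'I_d}) : n.-tuple W := [tuple tnth b (k i) | i < n].

Let mlin_sum (U : lmodType K) (f : n.-tuple W -> U) : multilinear f ->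
  forall w i, f w = \sum_(j < d) coord b j (tnth w i) *: f (set_tnth w i (tnth b j)).
Proof.
move=> fP w i.
have f0 : f (set_tnth w i 0) = 0.
  have := fP w i (-1) 0 0.
  by rewrite scaler0 addr0 scaleN1r addNr.
have fs (r : seq 'I_d) (c : 'I_d -> K) :
    f (set_tnth w i (\sum_(j <- r) c j *: tnth b j)) =
    \sum_(j <- r) c j *: f (set_tnth w i (tnth b j)).
  by elim: r => [|j r IH]; rewrite ?big_nil ?big_cons ?fP ?IH.
rewrite -fs; congr f; apply: eq_from_tnth => j; rewrite tnth_set.
case: eqP => // ->; rewrite [LHS](coord_vbasis (memvf _)).
by apply: eq_bigr => l _; rewrite [tnth b l](tnth_nth 0).
Qed.

(* Two multilinear maps agreeing on tuples of basis vectors are equal. *)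
Let mlin_ext (U : lmodType K) (f g : n.-tuple W -> U) :
  multilinear f -> multilinear g -> (forall k, f (bvec k) = g (bvec k)) ->
  f =1 g.
Proof.
move=> fP gP fg.
suff H m : (m <= n)%N -> forall w : n.-tuple W,
    (forall i : 'I_n, (m <= i)%N -> exists j, tnth w i = tnth b j) -> f w = g w.
  by move=> w; apply: (H n) => // i; rewrite leqNgt ltn_ord.
elim: m => [_ w Hw|m IH mn w Hw].
  have Hw' i : exists j, tnth w i == tnth b j.
    by have [j ->] := Hw i isT; exists j.
  have -> : w = bvec [ffun i => xchoose (Hw' i)]; last exact: fg.
  apply: eq_from_tnth => i; rewrite tnth_mktuple ffunE.
  exact/eqP/(xchooseP (Hw' i)).
pose i := Ordinal mn.
rewrite (mlin_sum fP w i) (mlin_sum gP w i); apply: eq_bigr => j _.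
congr (_ *: _); apply: IH => [|l ml]; first exact: ltnW.
rewrite tnth_set; case: eqP => [_|/eqP li]; first by exists j.
apply: Hw; rewrite ltn_neqAle ml andbT.
by apply: contra li => /eqP e; apply/eqP/val_inj.
Qed.

Let tens_bvec k l : tens (bvec k) l = (l == k)%:R.
Proof.
rewrite ffunE; case: eqP => [->|/eqP lk].
  rewrite big1 // => i _; rewrite tnth_mktuple (tnth_nth 0) coord_free ?eqxx //.
  exact: basis_free (vbasisP _).
have [i li] : exists i, l i != k i.
  apply/existsP; apply: contraR lk; rewrite negb_exists => /forallP H.
  by apply/eqP/ffunP => i; apply/eqP; have := H i; rewrite negbK.
rewrite (bigD1 i) //= tnth_mktuple (tnth_nth 0) coord_free.
  by rewrite eq_sym (negPf li) mul0r.
exact: basis_free (vbasisP _).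
Qed.

Let comp_mlin (T U : lmodType K) (t : n.-tuple W -> T) (g : {linear T -> U}) :
  multilinear t -> multilinear (fun w => g (t w)).
Proof. by move=> tP w i a x y; rewrite tP linearP. Qed.

Lemma tensor_power_exists :
  exists (T : lmodType K) (t : n.-tuple W -> T), is_tensor_power t.
Proof.
exists {ffun {ffun 'I_n -> 'I_d} -> K^o}, tens; split=> [|U f fP].
  exact: tens_lin.
split=> [|g h gf hf x].
  pose g0 (x : {ffun {ffun 'I_n -> 'I_d} -> K^o}) : U :=
    \sum_k (x k : K) *: f (bvec k).
  have g0P : linear g0.
    move=> a x y; rewrite /g0 scaler_sumr -big_split; apply: eq_bigr => k _.
    by rewrite !ffunE scalerDl scalerA.
  pose gM := GRing.isLinear.Build K _ U _ g0 g0P.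
  pose g : {linear _ -> _} := HB.pack g0 gM.
  exists g; apply: mlin_ext => //; first exact: (comp_mlin g tens_lin).
  move=> k; rewrite /g /= /g0 (bigD1 k) //= tens_bvec eqxx scale1r big1 ?addr0 //.
  by move=> l /negPf lk; rewrite tens_bvec lk scale0r.
have -> : x = \sum_k (x k : K) *: tens (bvec k).
  apply/ffunP => l; rewrite sum_ffunE (bigD1 l) //= ffunE tens_bvec eqxx.
  rewrite big1 ?addr0 => [|k kl]; first by rewrite /GRing.scale /= mulr1.
  by rewrite ffunE tens_bvec eq_sym (negPf kl) scaler0.
by rewrite !linear_sum; apply: eq_bigr => k _; rewrite !linearZ /= gf hf.
Qed.

End Existence.

(* Main.v *)
(* Expanding every simple tensor w_1 (x) ... (x) w_4 in the basis e, the        *)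
(* coefficient of e_(k 1) (x) ... (x) e_(k 4) is \prod_i coord e (k i) w_i.     *)
(* With X i j = coord e (k i) e_j, both sides then have as coefficients         *)
(* polynomials in the matrix X, and twice their equality is the integral        *)
(* polynomial identity [det4_mul2] for a generic 4 x 4 matrix.                  *)

Require Import Defs.
From mathcomp Require Import all_boot all_order all_algebra all_fingroup.
From mathcomp Require Import ring.

Set Implicit Arguments.
Unset Strict Implicit.
Unset Printing Implicit Defensive.

Import GRing.Theory.
Local Open Scope ring_scope.

(** By multilinearity ([multilinear_coord]) the claim becomes one scalar identity for each index
    tuple [k], and [det4_mul2] supplies it. The reason behind it is Laplace expansion along the
    outer rows 0, 3 against the inner rows 1, 2. For columns a, b, (x_0a - x_0b)(x_3a + x_3b) = S +
    D with S = x_0a x_3a - x_0b x_3b and D the 2 x 2 minor; exchanging the two signs gives S - D.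
    With S', D' likewise for rows 1, 2 and the complementary columns, the two sign patterns add up
    to 2(SS' + DD'). Over the six column pairs, the signed DD' sum to the determinant and the signed
    SS' cancel. *)

Lemma set_tnth_cons (A : Type) (n : nat) (x y : A) (w : n.-tuple A) :
  set_tnth [tuple of x :: w] ord0 y = [tuple of y :: w].
Proof.
apply: eq_from_tnth => i; rewrite tnth_mktuple.
by case: (unliftP ord0 i) => [j|] ->; rewrite ?tnthS ?tnth0.
Qed.

Lemma set_tnth_cons_lift (A : Type) (n : nat) (x y : A) (w : n.-tuple A)
    (i : 'I_n) :
  set_tnth [tuple of x :: w] (lift ord0 i) y = [tuple of x :: set_tnth w i y].
Proof.
apply: eq_from_tnth => j; rewrite tnth_mktuple.
case: (unliftP ord0 j) => [l|] ->; last by rewrite !tnth0.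
by rewrite !tnthS tnth_mktuple (inj_eq lift_inj).
Qed.

Section Multilinear.

Variables (K : fieldType) (W : vectType K) (U : lmodType K).

Lemma multilinear_cons (n : nat) (f : n.+1.-tuple W -> U) (x : W) :
  multilinear f -> multilinear (fun w : n.-tuple W => f [tuple of x :: w]).
Proof. by move=> fP w i a y z; rewrite -!set_tnth_cons_lift fP. Qed.

Lemma multilinear_sum_head (n : nat) (f : n.+1.-tuple W -> U) (I : Type)
    (r : seq I) (c : I -> K) (v : I -> W) (w : n.-tuple W) :
  multilinear f ->
  f [tuple of \sum_(j <- r) c j *: v j :: w] =
  \sum_(j <- r) c j *: f [tuple of v j :: w].
Proof.
move=> fP; have fD a x y : f [tuple of a *: x + y :: w] =
    a *: f [tuple of x :: w] + f [tuple of y :: w].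
  by have := fP [tuple of 0 :: w] ord0 a x y; rewrite !set_tnth_cons.
elim: r => [|j r IH]; last by rewrite !big_cons fD IH.
(* For the empty sum, linearity in the head with a = -1 and x = y = 0 gives f(0 :: w) = -f(0 :: w) +
   f(0 :: w) = 0. *)
by rewrite !big_nil; have := fD (-1) 0 0; rewrite scaler0 addr0 scaleN1r addNr.
Qed.

(** Induction on [n]: expand the head in the basis, then apply the hypothesis to the map of the
    tail, which is again multilinear. *)
Lemma multilinear_coord (d n : nat) (e : d.-tuple W) (f : n.-tuple W -> U)
    (w : n.-tuple W) :
  basis_of fullv e -> multilinear f ->
  f w = \sum_(k : n.-tuple 'I_d)
    (\prod_i coord e (tnth k i) (tnth w i)) *: f (map_tuple (tnth e) k).
Proof.
move=> eP; elim: n => [|n IH] in f w * => fP.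
  rewrite (bigD1 [tuple]) //= big_ord0 scale1r big1 ?addr0 => [|k].
    by congr (f _); rewrite (tuple0 w) [RHS]tuple0.
  by rewrite (tuple0 k) => /eqP[].
case/tupleP: w => x w; rewrite [in LHS](coord_basis eP (memvf x)).
rewrite multilinear_sum_head //.
rewrite (reindex (fun p : 'I_d * n.-tuple 'I_d => [tuple of p.1 :: p.2])) /=;
  last first.
  exists (fun k => (thead k, [tuple of behead k])) => [[j k] _|k _] /=.
    by congr pair; apply: val_inj.
  by rewrite -tuple_eta.
rewrite -(pair_bigA _ (fun (j : 'I_d) (k : n.-tuple 'I_d) =>
  (\prod_i coord e (tnth [tuple of j :: k] i) (tnth [tuple of x :: w] i)) *:
  f (map_tuple (tnth e) [tuple of j :: k]))) /=.
apply: eq_bigr => j _.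
rewrite -(tnth_nth 0) (IH _ w (multilinear_cons _ fP)) scaler_sumr.
apply: eq_bigr => k _; rewrite scalerA big_ord_recl !tnth0.
congr (_ * _ *: f _); last exact: val_inj.
by apply: eq_bigr => i _; rewrite !tnthS.
Qed.

End Multilinear.

(** [q a b c d] collects the four terms of the split {a, b} | {c, d} of the columns. The factor 2 on
    the left avoids division, so [ring] can decide the identity once the determinant is expanded. *)
Lemma det4_mul2 (R : comNzRingType) (x : nat -> nat -> R) :
  let p i j k := x i j + x i k in
  let m i j k := x i j - x i k in
  let q a b c d :=
    m 0%N a b * m 1%N c d * p 2%N c d * p 3%N a b
    + m 0%N c d * m 1%N a b * p 2%N a b * p 3%N c d
    + p 0%N a b * p 1%N c d * m 2%N c d * m 3%N a b
    + p 0%N c d * p 1%N a b * m 2%N a b * m 3%N c d in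
  2%:R * \det (\matrix_(i < 4, j < 4) x i j) =
  q 0%N 1%N 2%N 3%N - q 0%N 2%N 1%N 3%N + q 0%N 3%N 1%N 2%N.
Proof.
move=> p m q.
do 3 rewrite !(expand_det_row _ ord0) !big_ord_recl !big_ord0 /cofactor.
rewrite !det_mx11 !mxE /= /bump /=.
rewrite /q /p /m; ring.
Qed.

Theorem theorem4p1 (K : fieldType) (char_neq2 : 2%N \notin [pchar K])
    (V : vectType K) (dimV : \dim {:V} = 4%N)
    (e1 e2 e3 e4 : dual V)
    (e_basis : basis_of {:dual V} [tuple e1; e2; e3; e4])
    (T : lmodType K) (t : 4.-tuple (dual V) -> T) (tP : is_tensor_power t) :
  det_tensor t [tuple e1; e2; e3; e4] =
  2%:R^-1 *: (
      t [tuple e1 - e2; e3 - e4; e3 + e4; e1 + e2]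
    - t [tuple e1 - e3; e2 - e4; e2 + e4; e1 + e3]
    + t [tuple e1 - e4; e2 - e3; e2 + e3; e1 + e4]
    + t [tuple e2 - e3; e1 - e4; e1 + e4; e2 + e3]
    - t [tuple e2 - e4; e1 - e3; e1 + e3; e2 + e4]
    + t [tuple e3 - e4; e1 - e2; e1 + e2; e3 + e4]
    + t [tuple e1 + e2; e3 + e4; e3 - e4; e1 - e2]
    - t [tuple e1 + e3; e2 + e4; e2 - e4; e1 - e3]
    + t [tuple e1 + e4; e2 + e3; e2 - e3; e1 - e4]
    + t [tuple e2 + e3; e1 + e4; e1 - e4; e2 - e3]
    - t [tuple e2 + e4; e1 + e3; e1 - e3; e2 - e4]
    + t [tuple e3 + e4; e1 + e2; e1 - e2; e3 - e4]).
Proof.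
have t_mlin : multilinear t by case: tP.
have two_neq0 : 2%:R != 0 :> K by move: char_neq2; rewrite inE.
(* The factor 1/2 moves to the left as 2, the shape of [det4_mul2]. *)
apply: (canRL (scalerK two_neq0)).
rewrite /det_tensor scaler_sumr.
under eq_bigr => s _ do
  rewrite (multilinear_coord _ e_basis t_mlin) !scaler_sumr.
rewrite exchange_big /=.
rewrite !(multilinear_coord _ e_basis t_mlin).
rewrite -!sumrN -!big_split /=; apply: eq_bigr => k _.
under eq_bigr => s _ do rewrite !scalerA.
(* It suffices to match the coefficients at each [k]. *)
rewrite -scaler_suml -!scaleNr -!scalerDl; congr (_ *: _).
(* Indices are naturals, as in [det4_mul2]; the defaults [ord0] and [0] are never reached for i, j <
   4. *)
pose x i j :=
  coord [tuple e1; e2; e3; e4] (nth ord0 k i) (nth 0 [:: e1; e2; e3; e4] j).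
transitivity (2%:R * \det (\matrix_(i < 4, j < 4) x i j)).
  rewrite mulr_sumr; apply: eq_bigr => s _; rewrite -mulrA; congr (_ * (_ * _)).
  by apply: eq_bigr => i _; rewrite mxE tnth_mktuple (tnth_nth ord0) (tnth_nth 0).
rewrite det4_mul2 !big_ord_recl !big_ord0 !(tnth_nth (0 : dual V)).
rewrite !(tnth_nth (ord0 : 'I_4)) /=.
rewrite /bump /= !(linearD, linearN) /= /x /=.
ring.
Qed.
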